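(* Let $d_v,d_c\ge 2$ and $\ell\ge 0$ be integers. There exists a constant $\beta=\beta(d_v,d_c,\ell)>0$ such that the following holds, both for decoders with permanently missing connections and for decoders with transiently missing connections. For the $(d_v,d_c)$-regular LDPC ensemble of length $n$, let $Z$ be the number of incorrect values held among all $n d_v$ edges at the end of the $\ell$th decoding iteration, for a random choice of code graph, channel noise, and missing connections, and let $E[Z]$ be its expectation. Then for any $\varepsilon>0$, $$\Pr\big[\,|Z-E[Z]|>n d_v\varepsilon/2\,\big]\le 2e^{-\beta\varepsilon^2 n}.$$
   Context: Ensemble. The $(d_v,d_c)$-regular LDPC ensemble of length $n$ (with $d_c\mid n d_v$) is the random bipartite (Tanner) multigraph with $n$ variable nodes having $d_v$ sockets each and $n d_v/d_c$ check nodes having $d_c$ sockets each, in which the $n d_v$ variable sockets are matched to the $n d_v$ check sockets by a uniformly random permutation. Code symbols take values in $\{\pm1\}$. Channel. The all-one codeword is transmitted over a binary memoryless symmetric channel (for example a BSC with outputs in $\{\pm 1\}$ or a BEC with outputs in $\{\pm1,?\}$), so that the channel values received at the $n$ variable nodes are i.i.d. Message-passing decoder. In iteration $0$ each variable node forms, for each of its edges, a message that is a function of its received channel value. In each iteration $t\ge 1$, the variable-to-check messages formed in iteration $t-1$ are sent along the edges; each check node computes for each of its edges a message that is a fixed function of the messages received on its other $d_c-1$ edges and sends it; then each variable node computes for each of its edges a message that is a fixed function of its channel value and the check-to-variable messages received on its other $d_v-1$ edges. Whenever a connection (edge) is missing, any message sent along it, in either direction, is received as the erasure symbol ''$?$'',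 which belongs to the message alphabet. Missing connections. Let $\alpha\in[0,1]$. Permanently missing: before decoding starts, each edge is removed independently with probability $\alpha$ and stays missing in all iterations. Transiently missing: in each decoding iteration, each edge is missing independently with probability $\alpha$, independently over edges and iterations. Missing-connection randomness is independent of the graph and the channel. The value held on an edge at the end of iteration $\ell$ is the message computed for this edge by its variable node in iteration $\ell$; it is incorrect if it does not represent the transmitted symbol $+1$ (an erasure counts as incorrect). *)

(* Defs.v *)
From HB Require Import structures.
From mathcomp Require Import all_boot all_order all_algebra finmap.
From mathcomp Require Import all_classical all_reals all_analysis.

Set Implicit Arguments.
Unset Strict Implicit.
Unset Printing Implicit Defensive.

Import Order.TTheory GRing.Theory Num.Theory.

Local Open Scope classical_set_scope.
Local Open Scope ring_scope.

(* Code symbols +1 and -1 are encoded as [true] and [false]. *)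
Definition symbol : Type := bool.
Definition plus_one : symbol := true.
Definition minus_one : symbol := false.

(* Mutual independence of a (possibly infinite) family of classes of events. *)
Definition mutually_independent (d : measure_display) (T : measurableType d)
    (R : realType) (P : probability T R) (I : choiceType)
    (F : I -> set_system T) : Prop :=
  forall (J : {fset I}) (E : I -> set T), (forall i, i \in J -> F i (E i)) ->
    P (\bigcap_(i in [set` J]) E i) = (\prod_(i <- J) P (E i))%E.

(* [W s] is the law of the channel output when the symbol [s] is sent.  The
   channel is symmetric if some measurable involution of the output alphabet
   exchanges the two laws. *)
Definition bms_channel (d : measure_display) (Y : measurableType d)
    (R : realType) (W : symbol -> probability Y R) : Prop :=
  exists flip : Y -> Y,
    [/\ measurable_fun [set: Y] flip, involutive flip &
        forall A, measurable A ->
          W minus_one A = W plus_one (flip @^-1` A)].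

(* An edge is identified with its variable socket: [(v, i)] is the edge at
   socket [i] of variable node [v].  A check socket is a pair (check node,
   position). *)
Definition edge (dv n : nat) : finType := ('I_n * 'I_dv)%type.
Definition check_socket (dv dc n : nat) : finType :=
  ('I_((n * dv) %/ dc) * 'I_dc)%type.

(* A matching sends every variable socket to a check socket.  When [dc] divides
   [n * dv] there are as many sockets on both sides, so that the injective maps
   are exactly the bijections. *)
Definition matching (dv dc n : nat) : finType :=
  {ffun edge dv n -> check_socket dv dc n}.
Definition perfect_matchings (dv dc n : nat) : {set matching dv dc n} :=
  [set g : matching dv dc n | injectiveb g].

(* The message alphabet [M] is any measurable type with a distinguished
   erasure; [represents m] is the symbol represented by [m], if any.  The
   deterministic maps are shared by all nodes and may depend on the iteration
   number (their first argument). *)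
Record decoder (dY dM : measure_display) (Y : measurableType dY)
    (M : measurableType dM) (dv dc : nat) := Decoder {
  erasure : M ;
  represents : M -> option symbol ;
  init_map : Y -> M ;
  check_map : nat -> (dc.-1).-tuple M -> M ;
  var_map : nat -> Y * (dv.-1).-tuple M -> M ;
  represents_erasure : represents erasure = None ;
  measurable_represents : forall s : option symbol,
    measurable (represents @^-1` [set s]) ;
  measurable_init_map : measurable_fun [set: Y] init_map ;
  measurable_check_map : forall t,
    measurable_fun [set: (dc.-1).-tuple M] (check_map t) ;
  measurable_var_map : forall t,
    measurable_fun [set: Y * (dv.-1).-tuple M] (var_map t) }.

Section message_passing.
Context (dY dM : measure_display) (Y : measurableType dY)
  (M : measurableType dM) (dv dc n : nat) (D : decoder Y M dv dc)
  (g : matching dv dc n) (y : 'I_n -> Y) (missing : nat -> edge dv n -> bool).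

Definition var_neighbor (e : edge dv n) (k : 'I_dv.-1) : edge dv n :=
  (e.1, lift e.2 k).

(* The edge at the [k]-th other socket of the check node of [e]; the default
   value [e] is never used for a perfect matching. *)
Definition check_neighbor (e : edge dv n) (k : 'I_dc.-1) : edge dv n :=
  odflt e [pick e' | g e' == ((g e).1, lift (g e).2 k)].

(* What is received when [m] is sent along [e] during iteration [t]. *)
Definition received (t : nat) (e : edge dv n) (m : M) : M :=
  if missing t e then erasure D else m.

(* The check-to-variable message computed for [e] in iteration [t], given the
   variable-to-check messages [v] formed in the previous iteration. *)
Definition check_message (t : nat) (v : edge dv n -> M) (e : edge dv n) : M :=
  check_map D t [tuple received t (check_neighbor e k) (v (check_neighbor e k))
                | k < dc.-1].

Fixpoint var_message (t : nat) (e : edge dv n) : M :=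
  match t with
  | 0 => init_map D (y e.1)
  | t'.+1 =>
      let c := check_message t (var_message t') in
      var_map D t (y e.1, [tuple received t (var_neighbor e k)
                                   (c (var_neighbor e k)) | k < dv.-1])
  end.

Definition incorrect_count (l : nat) : nat :=
  #|[pred e : edge dv n | represents D (var_message l e) != Some plus_one]|.

End message_passing.

Section random_model.
Context (d dY : measure_display) (T : measurableType d) (Y : measurableType dY)
  (R : realType) (P : probability T R) (dv dc n : nat) (K : choiceType)
  (G : T -> matching dv dc n) (X : 'I_n -> {RV P >-> Y})
  (B : K -> {RV P >-> bool}).

(* The events generated by the matching, by each channel value and by each
   missing-connection flag. *)
Definition generated_events (i : option ('I_n + K)) : set_system T :=
  match i with
  | None => preimage_set_system [set: T] G [set: set (matching dv dc n)]
  | Some (inl v) => preimage_set_system [set: T] (X v) measurable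
  | Some (inr k) => preimage_set_system [set: T] (B k) measurable
  end.

(* [G] is a uniformly random matching, [X] are the channel values when the
   all-one codeword is sent over [W], [B] are the missing-connection flags. *)
Record random_model (W : symbol -> probability Y R) (alpha : R) : Prop := {
  matching_measurable : forall h, measurable (G @^-1` [set h]) ;
  matching_uniform : forall h, h \in perfect_matchings dv dc n ->
    P (G @^-1` [set h]) = (#|perfect_matchings dv dc n|%:R^-1)%:E ;
  channel_law : forall v A, measurable A ->
    distribution P (X v) A = W plus_one A ;
  flag_law : forall k A, distribution P (B k) A = bernoulli_prob alpha A ;
  model_independent : mutually_independent P generated_events }.

End random_model.

Definition concentration (d : measure_display) (T : measurableType d)
    (R : realType) (P : probability T R) (dv n : nat) (beta : R)
    (Z : T -> nat) : Prop :=
  forall eps : R, 0 < eps ->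
    (P [set w | (((n * dv)%:R * eps / 2)%:E <
                 `| ((Z w)%:R)%:E - 'E_P[(fun w => (Z w)%:R : R)] |)%E]
     <= (2 * expR (- (beta * eps ^+ 2 * n%:R)))%:E)%E.

(* Main.v *)
(* The moment generating function of Z - E Z is bounded by an Azuma-McDiarmid
   argument.  For a fixed matching, Z is a function of the n channel values and
   of the missing-connection flags, which are independent.  Changing one of them
   changes only the messages in a neighbourhood of depth l, hence Z by at most a
   constant depending on dv, dc and l; integrating the variables out one at a
   time, each contributes a constant factor by Hoeffding's lemma.  The mean of Z
   given the matching changes by a bounded amount when two check sockets are
   swapped, so exposing the matching edge by edge contributes one such factor per
   edge.  There are O(n) factors in all, and Chernoff's bound concludes.

   Only the flags of iterations up to l matter, so that a finite list of flags
   suffices even for transiently missing connections. *)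

Require Import Defs.
From HB Require Import structures.
From mathcomp Require Import all_boot all_order all_algebra finmap.
From mathcomp Require Import all_classical all_reals all_analysis.
From mathcomp Require Import perm measurable_realfun ring lra zify.

Set Implicit Arguments.
Unset Strict Implicit.
Unset Printing Implicit Defensive.

Import Order.TTheory GRing.Theory Num.Theory.

Local Open Scope classical_set_scope.
Local Open Scope ring_scope.

(** * Bounded measurable functions and Hoeffding's lemma *)

(** The linear term vanishes in the mean of a centred variable, which leaves Hoeffding's bound with
    a non-optimal constant. For [x <= 1/2], [expR x <= 1 / (1 - x) <= 1 + x + 2 * x ^+ 2]; for
    larger [x], already [x <= 2 * x ^+ 2]. *)
Lemma expR_le_addr_expR_sqr (R : realType) (x : R) :
  expR x <= x + expR (2 * x ^+ 2).
Proof.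
have h := expR_ge1Dx (2 * x ^+ 2).
have [x2|x2] := leP x 2^-1; last first.
  apply: (@le_trans _ _ (expR (2 * x ^+ 2))); last by rewrite lerDr; lra.
  by rewrite ler_expR; nra.
have h1 := expR_ge1Dx (- x).
have x1 : 0 < 1 - x by lra.
have : expR x <= (1 - x)^-1.
  by rewrite -[expR x]invrK -expRN lef_pV2 ?posrE ?expR_gt0.
move=> /le_trans; apply; rewrite -[leLHS]mul1r ler_pdivrMr//.
have : 1 <= (1 + x + 2 * x ^+ 2) * (1 - x).
  have -> : (1 + x + 2 * x ^+ 2) * (1 - x) = 1 + x ^+ 2 * (1 - 2 * x) by ring.
  by rewrite lerDl mulr_ge0 ?sqr_ge0//; lra.
move=> /le_trans; apply; rewrite ler_pM2r//; lra.
Qed.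

Section bounded_measurable.
Context (R : realType) (d : measure_display) (S : measurableType d).
Implicit Types (F G : S -> R) (c : R).

(** Bounded measurable functions are integrable for every probability and stable under the
    operations below, which settles the integrability side conditions. *)
Definition bmf F := measurable_fun setT F /\ exists c, forall x, `|F x| <= c.

Lemma bmf_cst c : bmf (fun=> c).
Proof. by split; [exact: measurable_cst|exists `|c|]. Qed.

Lemma bmfD F G : bmf F -> bmf G -> bmf (fun x => F x + G x).
Proof.
move=> [mF [a Fa]] [mG [b Gb]]; split; first exact: measurable_funD.
by exists (a + b) => x; rewrite (le_trans (ler_normD _ _)) ?lerD.
Qed.

Lemma bmfM F G : bmf F -> bmf G -> bmf (fun x => F x * G x).
Proof.
move=> [mF [a Fa]] [mG [b Gb]]; split; first exact: measurable_funM.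
by exists (a * b) => x; rewrite normrM ler_pM.
Qed.

Lemma bmfZ c F : bmf F -> bmf (fun x => c * F x).
Proof. by move=> bF; apply: bmfM => //; exact: bmf_cst. Qed.

Lemma bmfB F G : bmf F -> bmf G -> bmf (fun x => F x - G x).
Proof.
move=> bF bG; have -> : (fun x => F x - G x) = (fun x => F x + -1 * G x).
  by apply/funext => x; rewrite mulN1r.
by apply: bmfD => //; exact: bmfZ.
Qed.

Lemma bmf_expR F : bmf F -> bmf (fun x => expR (F x)).
Proof.
move=> [mF [a Fa]]; split; first exact: measurableT_comp mF.
exists (expR a) => x; rewrite ger0_norm ?expR_ge0// ler_expR.
exact: le_trans (ler_norm _) (Fa x).
Qed.

Lemma bmf_sum (K : Type) (s : seq K) (F : K -> S -> R) :
  (forall k, bmf (F k)) -> bmf (fun x => \sum_(k <- s) F k x).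
Proof.
move=> bF; elim: s => [|k s IH].
  by under eq_fun do rewrite big_nil; exact: bmf_cst.
by under eq_fun do rewrite big_cons; exact: bmfD.
Qed.

Lemma bmf_indic (b : S -> bool) :
  measurable [set x | b x] -> bmf (fun x => (b x)%:R).
Proof.
move=> mb; split; last by exists 1 => x; case: (b x); rewrite ?normr1 ?normr0.
have -> : (fun x => (b x)%:R) = \1_[set x | b x] :> (S -> R).
  by apply/funext => x; rewrite indicE mem_setE.
exact: measurable_indic.
Qed.

Context (P : probability S R).

Lemma bmf_integrable F : bmf F -> P.-integrable setT (EFin \o F).
Proof.
move=> [mF [a Fa]]; apply: measurable_bounded_integrable => //.
  exact: le_lt_trans (probability_le1 P measurableT) (ltry 1).
exists a; split; first exact: num_real.
by move=> b ab x _ /=; exact: le_trans (Fa x) (ltW ab).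
Qed.

Lemma expect_cst c : \int[P]_x c = c.
Proof.
rewrite Rintegral_cst// (_ : fine _ = 1) ?mulr1//.
exact: (congr1 (@fine R) (probability_setT P)).
Qed.

Lemma expectD F G : bmf F -> bmf G ->
  \int[P]_x (F x + G x) = \int[P]_x F x + \int[P]_x G x.
Proof. by move=> bF bG; rewrite RintegralD//; exact: bmf_integrable. Qed.

Lemma expectB F G : bmf F -> bmf G ->
  \int[P]_x (F x - G x) = \int[P]_x F x - \int[P]_x G x.
Proof. by move=> bF bG; rewrite RintegralB//; exact: bmf_integrable. Qed.

Lemma expectZ c F : bmf F -> \int[P]_x (c * F x) = c * \int[P]_x F x.
Proof. by move=> bF; rewrite RintegralZl//; exact: bmf_integrable. Qed.

Lemma expect_sum (K : Type) (s : seq K) (F : K -> S -> R) :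
  (forall k, bmf (F k)) ->
  \int[P]_x (\sum_(k <- s) F k x) = \sum_(k <- s) \int[P]_x F k x.
Proof.
move=> bF; elim: s => [|k s IH].
  rewrite big_nil -[RHS](expect_cst 0); apply: eq_Rintegral => x _.
  by rewrite big_nil.
rewrite big_cons -IH -expectD//; last exact: bmf_sum.
by apply: eq_Rintegral => x _; rewrite big_cons.
Qed.

Lemma le_expect F G : bmf F -> bmf G -> (forall x, F x <= G x) ->
  \int[P]_x F x <= \int[P]_x G x.
Proof. by move=> bF bG FG; apply: le_Rintegral => //; exact: bmf_integrable. Qed.

Lemma le_norm_expect F c : bmf F -> (forall x, `|F x| <= c) ->
  `|\int[P]_x F x| <= c.
Proof.
move=> bF Fc; rewrite ler_norml -{1}(expect_cst (- c)) -{2}(expect_cst c).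
apply/andP; split; apply: le_expect => //; try exact: bmf_cst.
  by move=> x; have := Fc x; rewrite ler_norml => /andP[].
by move=> x; have := Fc x; rewrite ler_norml => /andP[].
Qed.

Lemma expect_indic (b : S -> bool) : measurable [set x | b x] ->
  ((\int[P]_x (b x)%:R)%:E = P [set x | b x])%E.
Proof.
move=> mb; rewrite /Rintegral fineK; last first.
  exact: integrable_fin_num (bmf_integrable (bmf_indic mb)).
rewrite -[X in P X]setIT -integral_indic//; apply: eq_integral => x _.
by rewrite indicE mem_setE.
Qed.

Lemma hoeffding_lemma F c (t : R) : bmf F ->
    (forall x y, `|F x - F y| <= c) ->
  \int[P]_x expR (t * (F x - \int[P]_y F y)) <= expR (2 * (t * c) ^+ 2).
Proof.
move=> bF Fc; set m := \int[P]_y F y.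
have Fm x : `|F x - m| <= c.
  have bFx : bmf (fun y => F x - F y) by apply: bmfB => //; exact: bmf_cst.
  (* [F x - m] is the mean of [F x - F y] over [y]. *)
  rewrite /m -{1}(expect_cst (F x)) -expectB//; last exact: bmf_cst.
  exact: le_norm_expect.
have bFm : bmf (fun x => F x - m) by apply: bmfB => //; exact: bmf_cst.
apply: (@le_trans _ _
    (\int[P]_x (t * (F x - m) + expR (2 * (t * c) ^+ 2)))).
  apply: le_expect => [||x].
  - exact/bmf_expR/bmfZ.
  - by apply: bmfD; [exact: bmfZ|exact: bmf_cst].
  - apply: le_trans (expR_le_addr_expR_sqr _) _.
    rewrite lerD2l ler_expR ler_pM2l// !exprMn ler_wpM2l ?sqr_ge0//.
    by rewrite -(real_normK (num_real (F x - m))) lerXn2r// nnegrE// (le_trans _ (Fm x)).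
rewrite expectD; [|exact: bmfZ|exact: bmf_cst].
rewrite expectZ// expectB//; last exact: bmf_cst.
by rewrite !expect_cst subrr mulr0 add0r.
Qed.

End bounded_measurable.

(** * Resampling one independent coordinate *)

Section resampling.
Context (R : realType) (d : measure_display) (T : measurableType d)
  (P : probability T R) (I : choiceType) (F : I -> set_system T).

(* Every coordinate [i] gets its own sample point: a function of independent
   variables becomes a function on [I -> T], whatever the types of their values,
   and the original random variable is its restriction to the diagonal. *)
Definition rectangles : set_system (I -> T) :=
  [set A | exists E : I -> set T, exists J : {fset I},
     [/\ forall i, F i (E i), forall i, i \notin J -> E i = setT &
         A = [set x | forall i, E i (x i)]]].

Definition joint := g_sigma_algebraType rectangles.

Definition upd (x : I -> T) (i : I) (u : T) : joint :=
  fun j => if j == i then u else x j.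

Definition diag (w : T) : joint := fun=> w.

(** For independent coordinates, this plays the part of the conditional expectation given all
    coordinates but [i]. *)
Definition resample (i : I) (H : joint -> R) (x : joint) : R :=
  \int[P]_u H (upd x i u).

Lemma upd_upd x i u v : upd (upd x i u) i v = upd x i v.
Proof. by apply/funext => j; rewrite /upd; case: eqP. Qed.

Lemma updC x i j u v : i != j ->
  upd (upd x i u) j v = upd (upd x j v) i u.
Proof.
move=> ij; apply/funext => k; rewrite /upd.
by case: eqVneq => // ->; rewrite eq_sym (negbTE ij).
Qed.

Hypothesis F_measurable : forall i A, F i A -> measurable A.
Hypothesis F_setT : forall i, F i setT.
Hypothesis F_setI : forall i, setI_closed (F i).
Hypothesis F_indep : mutually_independent P F.

Lemma rectangles_setI : setI_closed rectangles.
Proof.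
move=> _ _ [E [J [FE JE ->]]] [E' [J' [FE' JE' ->]]].
exists (fun i => E i `&` E' i), (J `|` J')%fset; split.
- by move=> i; exact: F_setI.
- by move=> i; rewrite inE negb_or => /andP[iJ iJ']; rewrite JE// JE'// setIT.
- by apply/seteqP; split => x /=; [move=> [? ?] i; split|move=> h; split=> i; case: (h i)].
Qed.

Lemma rectangles_setT : rectangles setT.
Proof.
by exists (fun=> setT), fset0; split => //; apply/seteqP; split.
Qed.

Lemma measurable_rectangle (E : I -> set T) (J : {fset I}) :
  (forall i, F i (E i)) -> (forall i, i \notin J -> E i = setT) ->
  measurable [set x : joint | forall i, E i (x i)].
Proof. by move=> FE JE; apply: sub_sigma_algebra; exists E, J. Qed.

Lemma rectangle_diagE (E : I -> set T) (J : {fset I}) :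
  (forall i, i \notin J -> E i = setT) ->
  [set w | forall i, E i w] = \bigcap_(i in [set` J]) E i.
Proof.
move=> JE; apply/seteqP; split => [x /= h i _|x /= h i]; first exact: h.
by have [iJ|/JE ->//] := boolP (i \in J); exact: h.
Qed.

Lemma measurable_rectangle_diag (E : I -> set T) (J : {fset I}) :
  (forall i, F i (E i)) -> (forall i, i \notin J -> E i = setT) ->
  measurable [set w | forall i, E i w].
Proof.
move=> FE /rectangle_diagE ->; apply: fin_bigcap_measurable => [|i _].
  exact: finite_fset.
exact: F_measurable (FE i).
Qed.

Lemma measurable_diag : measurable_fun setT diag.
Proof.
apply: (@measurability _ _ _ joint _ _ rectangles) => // _ [_ [E [J [FE JE ->]]] <-].
by rewrite setTI; exact: measurable_rectangle_diag FE JE.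
Qed.

Lemma preimage_upd_rectangle (E : I -> set T) i :
  [set p : joint * T | forall j, E j (upd p.1 i p.2 j)] =
  [set x : joint | forall j, (if j == i then setT else E j) (x j)] `*` E i.
Proof.
apply/seteqP; split => [[x u] /= h|[x u] /= [h Eu] j].
  split=> [j|]; last by have := h i; rewrite /upd eqxx.
  by have := h j; rewrite /upd; case: eqP.
by have := h j; rewrite /upd; case: eqP => // ->.
Qed.

Lemma measurable_upd i :
  measurable_fun setT (fun p : joint * T => upd p.1 i p.2).
Proof.
apply: (@measurability _ _ _ joint _ _ rectangles) => // _ [_ [E [J [FE JE ->]]] <-].
rewrite setTI (_ : _ @^-1` _ =
  [set p : joint * T | forall j, E j (upd p.1 i p.2 j)])//.
rewrite preimage_upd_rectangle; apply: measurableX; last exact: F_measurable (FE i).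
apply: (@measurable_rectangle (fun j => if j == i then setT else E j) J) => j;
  first by case: eqP.
by case: eqP => // _; exact: JE.
Qed.

Lemma measurable_upd_diag i :
  measurable_fun setT (fun p : T * T => upd (diag p.1) i p.2).
Proof.
have mg : measurable_fun setT (fun p : T * T => (diag p.1, p.2)).
  apply: measurable_fun_pair => //.
  exact: measurableT_comp measurable_diag measurable_fst.
exact: measurableT_comp (measurable_upd i) mg.
Qed.

Lemma measurable_updr (x : joint) i : measurable_fun setT (fun u : T => upd x i u).
Proof.
have mg : measurable_fun setT (fun u : T => (x, u)).
  exact: measurable_fun_pair.
exact: measurableT_comp (measurable_upd i) mg.
Qed.

Let diag_mfun : {mfun T >-> joint} :=
  HB.pack diag (isMeasurableFun.Build _ _ _ _ _ measurable_diag).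

Let upd_diag_mfun i : {mfun (T * T)%type >-> joint} :=
  HB.pack (fun p : T * T => upd (diag p.1) i p.2)
    (isMeasurableFun.Build _ _ _ _ _ (measurable_upd_diag i)).

(* Independence enters here: replacing coordinate [i] by a fresh copy does not
   change the law on the pi-system of rectangles. *)
Lemma rectangle_resample i A : rectangles A ->
  P (diag @^-1` A) =
  (P \x P)%E ((fun p : T * T => upd (diag p.1) i p.2) @^-1` A).
Proof.
move=> [E [J [FE JE ->]]].
pose E' j := if j == i then setT else E j.
have FE' j : F j (E' j) by rewrite /E'; case: eqP.
have JE' j : j \notin J -> E' j = setT by rewrite /E'; case: eqP => // _; exact: JE.
have -> : (fun p : T * T => upd (diag p.1) i p.2) @^-1`
    [set x | forall i0, E i0 (x i0)] = [set w | forall j, E' j w] `*` E i.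
  apply/seteqP; split => [[x u] /= h|[x u] /= [h Eu] j].
    split=> [j|]; last by have := h i; rewrite /upd eqxx.
    by have := h j; rewrite /upd /E'; case: eqP.
  by have := h j; rewrite /upd /E'; case: eqP => // ->.
rewrite product_measure1E; [|exact: measurable_rectangle_diag FE' JE'|
  exact: F_measurable (FE i)].
(* With [i] added to the support, the factor at [i] splits off from both products; it is 1 for
   [E']. *)
pose K := (i |` J)%fset.
have KE j : j \notin K -> E j = setT.
  by rewrite !inE negb_or => /andP[_]; exact: JE.
have KE' j : j \notin K -> E' j = setT.
  by rewrite !inE negb_or => /andP[_]; exact: JE'.
rewrite (_ : diag @^-1` _ = [set w | forall j, E j w])//.
rewrite (rectangle_diagE KE) (rectangle_diagE KE').
transitivity (\prod_(j <- K) P (E j))%E; first exact: F_indep (fun j _ => FE j).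
transitivity ((\prod_(j <- K) P (E' j)) * P (E i))%E; last first.
  by congr (_ * _)%E; apply/esym; exact: F_indep (fun j _ => FE' j).
have iK : i \in K by rewrite !inE eqxx.
rewrite (big_fsetD1 i iK)/= (big_fsetD1 i iK)/= muleC; congr (_ * _)%E.
rewrite {1}/E' eqxx probability_setT mul1e.
apply: eq_big_seq => j; rewrite /E' !inE => /andP[/negbTE -> //].
Qed.

(** Rectangles form a pi-system that generates the sigma-algebra and contains the whole space, so
    two finite measures agreeing on them are equal. *)
Lemma measure_resample i (A : set joint) : measurable A ->
  P (diag @^-1` A) =
  (P \x P)%E ((fun p : T * T => upd (diag p.1) i p.2) @^-1` A).
Proof.
pose m1 : {measure set joint -> \bar R} := distribution P diag_mfun.
pose m2 : {measure set joint -> \bar R} :=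
  distribution (P \x P)%E (upd_diag_mfun i).
apply: (@measure_unique _ _ joint rectangles (fun=> setT) _ _ _ _ m1 m2) => //.
- exact: rectangles_setI.
- by move=> _; exact: rectangles_setT.
- by apply/seteqP; split => // x _; exists 0%N.
- by move=> B; exact: rectangle_resample.
- move=> _; exact: le_lt_trans (probability_le1 (distribution P diag_mfun) measurableT) (ltry 1).
Qed.

Lemma bmf_updr (H : joint -> R) x i : bmf H -> bmf (fun u => H (upd x i u)).
Proof.
move=> [mH [c Hc]]; split; last by exists c.
exact: measurableT_comp mH (measurable_updr x i).
Qed.

Lemma bmf_diag (H : joint -> R) : bmf H -> bmf (fun w => H (diag w)).
Proof.
move=> [mH [c Hc]]; split; last by exists c.
exact: measurableT_comp mH measurable_diag.
Qed.

Lemma bmf_resample i (H : joint -> R) : bmf H -> bmf (resample i H).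
Proof.
move=> bH; have [mH [c Hc]] := bH; split; last first.
  by exists c => x; apply: le_norm_expect => //; exact: bmf_updr.
have bHu : bmf (fun p : joint * T => H (upd p.1 i p.2)).
  by split; [exact: measurableT_comp mH (measurable_upd i)|exists c].
apply: measurableT_comp => //.
(* Fubini's theorem asks for a measure on [joint]; the partial integral over [u] is the same for any
   choice, and a Dirac mass serves. *)
exact: (measurable_fubini_F (bmf_integrable
  (dirac (point : joint) \x P : probability _ _)%E bHu)).
Qed.

(** The tower property: both sides are integrals of [H] against the two image measures compared in
    [measure_resample], the second one unfolded by Fubini. *)
Lemma expect_resample i (H : joint -> R) : bmf H ->
  \int[P]_w H (diag w) = \int[P]_w resample i H (diag w).
Proof.
move=> bH; have [mH [c Hc]] := bH.
have mHE : measurable_fun setT (EFin \o H) by exact/measurable_EFinP.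
have bHu : bmf (fun p : T * T => H (upd (diag p.1) i p.2)).
  by split; [exact: measurableT_comp mH (measurable_upd_diag i)|exists c].
congr fine.
transitivity (\int[P]_w \int[P]_u (H (upd (diag w) i u))%:E)%E; last first.
  apply: eq_integral => w _; rewrite fineK//.
  exact: integrable_fin_num (bmf_integrable P (bmf_updr (diag w) i bH)).
rewrite (integral12_prod_meas1 (bmf_integrable _ bHu)).
have := integral_distribution (P := P) (X := diag_mfun) mHE (bmf_integrable _ (bmf_diag bH)).
have := integral_distribution (P := (P \x P)%E) (X := upd_diag_mfun i) mHE (bmf_integrable _ bHu).
move=> <- <-; apply: eq_measure_integral => A mA _; exact: measure_resample.
Qed.

End resampling.

(** * Bounded differences *)

Section bounded_differences.
Context (R : realType) (d : measure_display) (T : measurableType d)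
  (P : probability T R) (I : choiceType) (F : I -> set_system T).

Hypothesis F_measurable : forall i A, F i A -> measurable A.
Hypothesis F_setT : forall i, F i setT.
Hypothesis F_setI : forall i, setI_closed (F i).
Hypothesis F_indep : mutually_independent P F.

Implicit Types (H : joint F -> R) (x : joint F) (s : seq I).

Definition determined_on s H :=
  forall x y, (forall i, i \in s -> x i = y i) -> H x = H y.

Definition resamples s H := foldl (fun H' i => resample P i H') H s.

Lemma resamples_cons i s H : resamples (i :: s) H = resamples s (resample P i H).
Proof. by []. Qed.

Lemma resample_upd i H x u : resample P i H (upd F x i u) = resample P i H x.
Proof. by apply: eq_Rintegral => v _; rewrite upd_upd. Qed.

Lemma resample_invariant i j H : (forall x u, H (upd F x i u) = H x) ->
  forall x u, resample P j H (upd F x i u) = resample P j H x.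
Proof.
move=> Hi x u; have [<-|ij] := eqVneq i j; first exact: resample_upd.
by apply: eq_Rintegral => v _; rewrite updC// Hi.
Qed.

Lemma resamples_invariant i s H : (forall x u, H (upd F x i u) = H x) ->
  forall x u, resamples s H (upd F x i u) = resamples s H x.
Proof.
elim: s H => [//|j s IH] H Hi; rewrite resamples_cons.
exact/IH/resample_invariant.
Qed.

Lemma bmf_resamples s H : bmf H -> bmf (resamples s H).
Proof.
elim: s H => [//|j s IH] H bH; rewrite resamples_cons.
by apply: IH; exact: bmf_resample.
Qed.

(** Each integration takes one coordinate off the list that determines the function. *)
Lemma resamples_cst s H : determined_on s H ->
  forall x y, resamples s H x = resamples s H y.
Proof.
elim: s H => [|i s IH] H Hs x y; first exact: Hs.
rewrite resamples_cons; apply: IH => x' y' xy'; apply: eq_Rintegral => u _.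
apply: Hs => j; rewrite inE /upd; case: eqVneq => //= _; exact: xy'.
Qed.

Lemma expect_resamples s H : bmf H ->
  \int[P]_w H (diag F w) = \int[P]_w resamples s H (diag F w).
Proof.
elim: s H => [//|i s IH] H bH; rewrite (expect_resample _ _ _ _ i)//.
by rewrite resamples_cons -IH//; exact: bmf_resample.
Qed.

(* Integrating out [i] first splits the deviation into [H - H1], controlled by
   Hoeffding's lemma in the single variable [i], and [H1 - resamples s H1],
   which no longer depends on [i]. *)
Lemma mgf_resamples s H c t : bmf H ->
    (forall i x u v, i \in s -> `|H (upd F x i u) - H (upd F x i v)| <= c) ->
  \int[P]_w expR (t * (H (diag F w) - resamples s H (diag F w))) <=
  expR ((size s)%:R * (2 * (t * c) ^+ 2)).
Proof.
elim: s H => [|i s IH] H bH Hc.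
  by under eq_Rintegral do rewrite /= subrr mulr0 expR0; rewrite expect_cst mul0r expR0.
rewrite resamples_cons; set H1 := resample P i H.
have bH1 : bmf H1 by exact: bmf_resample.
have H1inv x u : H1 (upd F x i u) = H1 x by exact: resample_upd.
have H1c j x u v : j \in s -> `|H1 (upd F x j u) - H1 (upd F x j v)| <= c.
  move=> js; have [<-|ij] := eqVneq i j.
    by rewrite !H1inv subrr normr0 (le_trans _ (Hc i x u v _))// inE eqxx.
  (* Updates at distinct coordinates commute, so the bound at [j] survives averaging over coordinate
     [i]. *)
  rewrite /H1 /resample -expectB; [|exact: bmf_updr..].
  apply: le_norm_expect => [|w]; first by apply: bmfB; exact: bmf_updr.
  by rewrite ![upd F (upd F _ j _) i w]updC 1?eq_sym// Hc// inE js orbT.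
set G := resamples s H1.
have bG : bmf G by exact: bmf_resamples.
have Ginv x u : G (upd F x i u) = G x by exact: resamples_invariant.
have bexp (A B : joint F -> R) : bmf A -> bmf B ->
    bmf (fun x => expR (t * (A x - B x))).
  by move=> bA bB; apply/bmf_expR/bmfZ/bmfB.
pose Phi x := expR (t * (H x - G x)).
have bPhi : bmf Phi by exact: bexp.
have bexpG : bmf (fun w => expR (t * (H1 (diag F w) - G (diag F w)))).
  by have := bmf_diag F_measurable (bexp _ _ bH1 bG).
rewrite [leLHS](_ : _ = \int[P]_w resample P i Phi (diag F w)); last first.
  exact: (expect_resample F_measurable F_setT F_setI F_indep i (H := Phi)).
apply: (@le_trans _ _ (\int[P]_w
    (expR (2 * (t * c) ^+ 2) * expR (t * (H1 (diag F w) - G (diag F w)))))).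
  apply: le_expect.
  - by apply: (bmf_diag F_measurable (H := resample P i Phi)); exact: bmf_resample.
  - exact: bmfZ.
  move=> w; set x := diag F w.
  have bHx : bmf (fun u => H (upd F x i u)) by exact: bmf_updr.
  (* [G] and [H1] ignore coordinate [i]: one factor leaves the integral over [u], and the other is
     the centred exponential moment of [H] in that variable alone. *)
  have -> : resample P i Phi x =
      expR (t * (H1 x - G x)) *
      \int[P]_u expR (t * (H (upd F x i u) - \int[P]_v H (upd F x i v))).
    rewrite -expectZ; last first.
      by apply/bmf_expR/bmfZ/bmfB => //; exact: bmf_cst.
    apply: eq_Rintegral => u _; rewrite /Phi Ginv -expRD -mulrDr; congr (expR (t * _)).
    by rewrite /H1 /resample; ring.
  rewrite mulrC ler_pM2r ?expR_gt0//; apply: hoeffding_lemma => // u v.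
  by apply: Hc; rewrite inE eqxx.
rewrite expectZ//.
rewrite [leRHS](_ : _ = expR (2 * (t * c) ^+ 2) *
    expR ((size s)%:R * (2 * (t * c) ^+ 2))); last first.
  by rewrite -expRD /= -natr1 mulrDl mul1r addrC.
by rewrite ler_pM2l ?expR_gt0//; exact: IH.
Qed.

(** Once all the determining coordinates are integrated out, [resamples s H] is constant, hence
    equal to the mean of [H]. *)
Lemma mgf_bounded_differences s H c t : bmf H -> determined_on s H ->
    (forall i x u v, i \in s -> `|H (upd F x i u) - H (upd F x i v)| <= c) ->
  \int[P]_w expR (t * (H (diag F w) - \int[P]_v H (diag F v))) <=
  expR ((size s)%:R * (2 * (t * c) ^+ 2)).
Proof.
move=> bH Hs Hc; apply: le_trans (mgf_resamples t bH Hc).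
rewrite le_eqVlt; apply/orP; left; apply/eqP; apply: eq_Rintegral => w _.
rewrite (expect_resamples s bH).
rewrite (_ : (fun v => resamples s H (diag F v)) = fun=> resamples s H (diag F w)).
  by rewrite expect_cst.
by apply/funext => v; exact: resamples_cst.
Qed.

End bounded_differences.

(** * Uniformly random injections *)

Section finite_means.
Context (R : realType).

(** Over an empty [A] the value is 0, so that [sum_mean] holds for every [A]. *)
Definition mean (J : finType) (A : pred J) (h : J -> R) : R :=
  (\sum_(a | A a) h a) / #|A|%:R.

Lemma sum_mean (J : finType) (A : pred J) (h : J -> R) :
  \sum_(a | A a) h a = #|A|%:R * mean A h.
Proof.
have [A0|A0] := eqVneq #|A| 0%N; last first.
  by rewrite /mean mulrC divfK// pnatr_eq0.
rewrite A0 mul0r big_pred0// => a.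
by have /card0_eq/(_ a) := A0.
Qed.

Lemma norm_sub_mean (J : finType) (A : pred J) (h : J -> R) (c : R) a :
  (forall a b, A a -> A b -> `|h a - h b| <= c) -> A a ->
  `|h a - mean A h| <= c.
Proof.
move=> hc Aa; have A0 : 0 < #|A|%:R :> R.
  by rewrite ltr0n; apply/card_gt0P; exists a.
rewrite -(ler_pM2l A0) -{1}(gtr0_norm A0) -normrM mulrBr -sum_mean.
have -> : #|A|%:R * h a = \sum_(b | A b) h a by rewrite sumr_const mulr_natl.
rewrite -sumrB (le_trans (ler_norm_sum _ _ _))//.
apply: (@le_trans _ _ (\sum_(b | A b) c)); last by rewrite sumr_const mulr_natl.
by apply: ler_sum => b Ab; exact: hc.
Qed.

Lemma finite_hoeffding (J : finType) (A : pred J) (h : J -> R) (c t : R) :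
  (forall a b, A a -> A b -> `|h a - h b| <= c) ->
  \sum_(a | A a) expR (t * (h a - mean A h)) <=
  #|A|%:R * expR (2 * (t * c) ^+ 2).
Proof.
move=> hc; apply: (@le_trans _ _
    (\sum_(a | A a) (t * (h a - mean A h) + expR (2 * (t * c) ^+ 2)))).
  apply: ler_sum => a Aa; apply: le_trans (expR_le_addr_expR_sqr _) _.
  rewrite lerD2l ler_expR ler_pM2l// !exprMn ler_wpM2l ?sqr_ge0//.
  have ac := norm_sub_mean hc Aa.
  rewrite -(real_normK (num_real (h a - mean A h))) lerXn2r// nnegrE//.
  exact: le_trans ac.
rewrite big_split/= -mulr_sumr sumrB sum_mean !sumr_const.
by rewrite -[mean A h *+ _]mulr_natl subrr mulr0 add0r [leRHS]mulr_natl.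
Qed.

End finite_means.

Section random_injection.
Context (R : realType) (E S : finType) (f : {ffun E -> S} -> R) (c t : R).
Implicit Types (g : {ffun E -> S}) (s : seq E).

Definition swap (a b : S) g : {ffun E -> S} := [ffun e => tperm a b (g e)].

Lemma swapK a b : involutive (swap a b).
Proof. by move=> g; apply/ffunP => e; rewrite !ffunE tpermK. Qed.

Lemma swapC a b g : swap a b g = swap b a g.
Proof. by apply/ffunP => e; rewrite !ffunE tpermC. Qed.

Lemma swap_inj a b g : injective g -> injective (swap a b g).
Proof. by move=> gi x y; rewrite !ffunE => /perm_inj /gi. Qed.

(** The values outside [s] are already exposed and given by [g0]; those on [s] are still random. *)
Definition extends s g0 : pred {ffun E -> S} :=
  [pred g : {ffun E -> S} | injectiveb g & [forall e, (e \notin s) ==> (g e == g0 e)]].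

Lemma extendsP s g0 g : reflect
  (injective g /\ forall e, e \notin s -> g e = g0 e) (extends s g0 g).
Proof.
apply: (iffP andP) => -[/injectiveP gi] h; split => //.
  by move=> e es; apply/eqP; move/forallP/(_ e)/implyP : h; exact.
by apply/forallP => e; apply/implyP => es; rewrite h.
Qed.

(** By injectivity of [g] and [g'], neither [g e] nor [g' e] is a value prescribed outside [e :: s],
    so the transposition moves no prescribed value. *)
Lemma extends_swap e s g0 g g' : extends (e :: s) g0 g ->
  extends (e :: s) g0 g' -> extends (e :: s) g0 (swap (g e) (g' e) g).
Proof.
move=> /extendsP[gi gg0] /extendsP[gi' gg0']; apply/extendsP; split.
  exact: swap_inj.
move=> e' e's; rewrite ffunE (gg0 e')//.
have ee' : e' != e by move: e's; rewrite inE negb_or => /andP[].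
rewrite tpermD//; apply: contra ee'.
  by rewrite -(gg0 _ e's) => /eqP/gi ->.
by rewrite -(gg0' _ e's) => /eqP/gi' ->.
Qed.

(** Conditioning on the value at [e] gives a family of the same form, to which induction applies. *)
Lemma extends_cons e s g0 g1 : e \notin s -> extends (e :: s) g0 g1 ->
  extends s g1 =1 [pred g | extends (e :: s) g0 g & g e == g1 e].
Proof.
move=> es /extendsP[gi1 g10] g; apply/idP/idP.
  move=> /extendsP[gi gg1]; rewrite /= gg1// eqxx andbT.
  apply/extendsP; split => // e'; rewrite inE negb_or => /andP[ee' e's].
  by rewrite gg1// g10// inE negb_or ee'.
move=> /andP[/extendsP[gi gg0] /eqP ge]; apply/extendsP; split => // e' e's.
have [->//|ee'] := eqVneq e' e.
by rewrite gg0 ?g10// inE negb_or ee'.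
Qed.

Hypothesis f_swap :
  forall g a b, injective g -> `|f (swap a b g) - f g| <= c.

(* Expose the value at [e]: swapping the values [a] and [b] is a bijection
   between the extensions sending [e] to [a] and those sending it to [b], so the
   conditional means differ by at most [c]. *)
Lemma mgf_extends s g0 : uniq s -> injective g0 ->
  \sum_(g | extends s g0 g) expR (t * (f g - mean (extends s g0) f)) <=
  #|extends s g0|%:R * expR ((size s)%:R * (2 * (t * c) ^+ 2)).
Proof.
elim: s g0 => [|e s IH] g0.
  move=> _ gi; have C0 : extends [::] g0 =1 pred1 g0.
    move=> g; apply/extendsP/eqP => [[_ h]|->//].
    by apply/ffunP => x; exact: h.
  rewrite (eq_bigl _ _ C0) big_pred1_eq/= mul0r expR0 mulr1.
  rewrite /mean (eq_bigl _ _ C0) big_pred1_eq (eq_card C0) card1 divr1.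
  by rewrite subrr mulr0 expR0.
move=> /= /andP[es us] gi0; set C := extends (e :: s) g0.
pose Ca a : pred {ffun E -> S} := [pred g | C g & g e == a].
pose N : pred S := [pred a | [exists g, Ca a g]].
have NP a : N a -> exists2 g1, C g1 & g1 e = a.
  by move=> /existsP[g /andP[Cg /eqP ge]]; exists g.
have Cag0 : C g0 by apply/extendsP; split.
have NCa g : C g -> N (g e) by move=> Cg; apply/existsP; exists g; apply/andP; split.
have swapCa a b g : N a -> N b -> Ca a g -> Ca b (swap a b g).
  move=> _ /NP[g2 Cg2 g2e] /andP[Cg /eqP ge].
  rewrite -ge -g2e; apply/andP; split; first exact: extends_swap.
  by rewrite ffunE tpermL.
have reCa a b F : N a -> N b ->
    \sum_(g | Ca b g) F g = \sum_(g | Ca a g) F (swap a b g) :> R.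
  move=> Na Nb; rewrite (reindex_inj (inv_inj (swapK a b))).
  apply: eq_bigl => g; apply/idP/idP; last exact: swapCa.
  by move=> /(swapCa _ _ _ Nb Na); rewrite (swapC b a) swapK.
(* All classes have the same size, so the value at [e] is uniform on [N] and the mean over [C] is
   the mean of the class means. *)
pose k := #|Ca (g0 e)|.
have kE a : N a -> #|Ca a| = k.
  move=> Na; apply/eqP; rewrite -(eqr_nat R).
  by have := reCa _ _ (fun=> 1) (NCa _ Cag0) Na; rewrite !sumr_const => ->.
have k0 : (0 < k)%N by apply/card_gt0P; exists g0; apply/andP; split.
pose m a := mean (Ca a) f.
have mc a b : N a -> N b -> `|m a - m b| <= c.
  move=> Na Nb; rewrite /m /mean !kE// -mulrBl (reCa a b)// -sumrB.
  rewrite normrM normfV [X in _ / X]ger0_norm// ler_pdivrMr ?ltr0n//.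
  rewrite (le_trans (ler_norm_sum _ _ _))//.
  apply: (@le_trans _ _ (\sum_(g | Ca a g) c)).
    apply: ler_sum => g /andP[/extendsP[gi _] _]; rewrite distrC; exact: f_swap.
  by rewrite sumr_const kE// mulr_natr.
have partC F : \sum_(g | C g) F g = \sum_(a | N a) \sum_(g | Ca a g) F g :> R.
  exact: partition_big.
have cardC : #|C|%:R = #|N|%:R * k%:R :> R.
  rewrite -[LHS]sumr_const partC mulrC mulr_natr -sumr_const.
  by apply: eq_bigr => a Na; rewrite sumr_const kE.
have meanC : mean C f = mean N m.
  rewrite /mean partC cardC (eq_bigr (fun a => k%:R * m a)); last first.
    by move=> a Na; rewrite sum_mean kE.
  by rewrite -mulr_sumr (mulrC k%:R) -mulf_div divff ?mulr1// pnatr_eq0 -lt0n.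
(* Induction bounds the deviation inside each class; the deviation of the class means is left to
   [finite_hoeffding]. *)
rewrite partC; apply: (@le_trans _ _ (\sum_(a | N a)
    expR (t * (m a - mean N m)) *
    (k%:R * expR ((size s)%:R * (2 * (t * c) ^+ 2))))).
  apply: ler_sum => a Na.
  have [g1 Cg1 g1e] := NP a Na.
  have CaE : extends s g1 =1 Ca a by move=> g; rewrite (extends_cons es Cg1)/= g1e.
  have := IH g1 us (proj1 (elimT (extendsP _ _ _) Cg1)).
  rewrite (eq_bigl _ _ CaE) (eq_card CaE) kE// (_ : mean _ f = m a); last first.
    by rewrite /m /mean (eq_bigl _ _ CaE) (eq_card CaE).
  move=> h; apply: le_trans (ler_wpM2l (expR_ge0 (t * (m a - mean N m))) h).
  rewrite mulr_sumr; apply: ler_sum => g _.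
  rewrite meanC -expRD ler_expR.
  have -> : t * (m a - mean N m) + t * (f g - m a) = t * (f g - mean N m) by ring.
  by [].
rewrite -mulr_suml cardC [leRHS](_ : _ = (#|N|%:R * expR (2 * (t * c) ^+ 2)) *
  (k%:R * expR ((size s)%:R * (2 * (t * c) ^+ 2)))); last first.
  by rewrite /= -natr1 mulrDl mul1r expRD; ring.
rewrite ler_pM2r ?mulr_gt0 ?expR_gt0 ?ltr0n//.
exact: finite_hoeffding.
Qed.

Lemma mgf_random_injection g0 (A := [pred g : {ffun E -> S} | injectiveb g]) :
  injective g0 ->
  \sum_(g | A g) expR (t * (f g - mean A f)) <=
  #|A|%:R * expR (#|E|%:R * (2 * (t * c) ^+ 2)).
Proof.
move=> gi; have := mgf_extends (enum_uniq E) gi.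
have CE : extends (enum E) g0 =1 A.
  move=> g; apply/extendsP/injectiveP => [[]//|h]; split => // e.
  by rewrite mem_enum.
by rewrite /mean !(eq_bigl _ _ CE) (eq_card CE) -cardE.
Qed.

End random_injection.

(** * Propagation of a local change *)

(** Double counting of the related pairs. *)
Lemma card_image_rel (E : finType) (r : rel E) (A : {set E}) (k : nat) :
  (forall a, #|[pred e | r a e]| <= k)%N ->
  (#|[set e | [exists a in A, r a e]]%SET| <= k * #|A|)%N.
Proof.
move=> rk; rewrite -sum1_card.
apply: (@leq_trans (\sum_(e : E) \sum_(a in A) r a e)).
  rewrite big_mkcond/=; apply: leq_sum => e _; rewrite inE.
  case: ifPn => // /existsP[a /andP[aA rae]].
  by rewrite (bigD1 a)//= rae.
rewrite exchange_big/=.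
apply: (@leq_trans (\sum_(a in A) k)); last by rewrite sum_nat_const mulnC.
apply: leq_sum => a _; apply: leq_trans (rk a).
by rewrite -sum1_card [leqRHS]big_mkcond/= leq_sum// => e _; rewrite inE; case: (r a e).
Qed.

Lemma card_le_in (E S : finType) (A : pred E) (h : E -> S) :
  {in A &, injective h} -> (#|A| <= #|S|)%N.
Proof. by move=> hi; rewrite -(card_in_image hi) max_card. Qed.

Lemma card_variable_edges dv n (v : 'I_n) :
  (#|[pred e : edge dv n | v == e.1]| <= dv)%N.
Proof.
rewrite -[leqRHS]card_ord; apply: (card_le_in (h := snd)) => -[a b] [a' b'].
by rewrite !inE/= => /eqP <- /eqP <- ->.
Qed.

Lemma card_check_edges dv dc n (g : matching dv dc n)
    (c : 'I_((n * dv) %/ dc)) : injective g ->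
  (#|[pred e : edge dv n | c == (g e).1]| <= dc)%N.
Proof.
move=> gi; rewrite -[leqRHS]card_ord.
apply: (card_le_in (h := fun e => (g e).2)) => e e'.
rewrite !inE => /eqP ce /eqP ce' ee'; apply: gi.
by rewrite [g e]surjective_pairing [g e']surjective_pairing ee' -ce -ce'.
Qed.

Section perturbation.
Context (dY dM : measure_display) (Y : measurableType dY)
  (M : measurableType dM) (dv dc n : nat) (D : decoder Y M dv dc).
Context (g g' : matching dv dc n) (y y' : 'I_n -> Y)
  (missing missing' : nat -> edge dv n -> bool) (U : {set edge dv n}).

Lemma check_neighbor_node (e : edge dv n) k :
  (g (check_neighbor g e k)).1 = (g e).1.
Proof. by rewrite /check_neighbor; case: pickP => //= e' /eqP ->. Qed.

Definition same_variable (A : {set edge dv n}) : {set edge dv n} :=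
  [set e | [exists a in A, a.1 == e.1]]%SET.

Definition same_check (A : {set edge dv n}) : {set edge dv n} :=
  [set e | [exists a in A, (g a).1 == (g e).1]]%SET.

(** An upper bound on the edges whose message can change when the data differ on [U]: an iteration
    spreads a change over a check node, then over a variable node. *)
Fixpoint affected (t : nat) : {set edge dv n} :=
  if t is t'.+1 then same_variable (same_check (affected t')) else U.

Lemma sub_same_variable (A : {set edge dv n}) : A \subset same_variable A.
Proof. by apply/fintype.subsetP => e eA; rewrite inE; apply/existsP; exists e; rewrite eA/=. Qed.

Lemma sub_same_check (A : {set edge dv n}) : A \subset same_check A.
Proof. by apply/fintype.subsetP => e eA; rewrite inE; apply/existsP; exists e; rewrite eA/=. Qed.

Lemma sub_affected t : U \subset affected t.
Proof.
elim: t => [//|t IH] /=; apply: fintype.subset_trans IH _.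
exact: fintype.subset_trans (sub_same_check _) (sub_same_variable _).
Qed.

Lemma card_affected t : injective g ->
  (#|affected t| <= #|U| * (dv * dc) ^ t)%N.
Proof.
move=> gi; elim: t => [|t IH] /=; first by rewrite expn0 muln1.
apply: leq_trans (card_image_rel _ (k := dv) _) _.
  by move=> a; exact: card_variable_edges.
apply: (@leq_trans (dv * (dc * #|affected t|))).
  rewrite leq_mul2l; apply/orP; right; apply: card_image_rel => a.
  exact: card_check_edges.
by rewrite expnS mulnA mulnCA leq_mul2l IH orbT.
Qed.

Hypothesis same_y : forall e, e \notin U -> y e.1 = y' e.1.
Hypothesis same_missing : forall t e, e \notin U -> missing t e = missing' t e.
Hypothesis same_neighbor : forall e k, e \notin U ->
  check_neighbor g e k = check_neighbor g' e k.

(** Outside [affected t.+1], every message read through the two half-steps comes from an edge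
    outside [affected t], along edges with equal flags and equal neighbours. *)
Lemma var_message_unaffected t e : e \notin affected t ->
  var_message D g y missing t e = var_message D g' y' missing' t e.
Proof.
have notU s e1 : e1 \notin affected s -> e1 \notin U.
  by apply: contra; exact/fintype.subsetP/sub_affected.
elim: t e => [|t IH] e eB /=; first by rewrite same_y.
congr (var_map D t.+1 (_, _)); first by rewrite same_y// (notU t.+1).
apply: eq_mktuple => k; set e1 := var_neighbor e k.
have e1B : e1 \notin same_check (affected t).
  apply: contra eB => e1B; rewrite /= inE; apply/existsP; exists e1.
  by rewrite e1B/=.
have e1U : e1 \notin U.
  apply: contra e1B; apply/fintype.subsetP.
  exact: fintype.subset_trans (sub_affected t) (sub_same_check _).
rewrite /received same_missing//; case: ifP => // _.
congr (check_map D t.+1 _); apply: eq_mktuple => j.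
rewrite -same_neighbor//; set e2 := check_neighbor g e1 j.
have e2B : e2 \notin affected t.
  apply: contra e1B => e2B; rewrite inE; apply/existsP; exists e2.
  by rewrite e2B check_neighbor_node eqxx.
by rewrite /received same_missing ?(notU t)// IH.
Qed.

(** Only edges of [affected l] can be counted on one side and not on the other. *)
Lemma incorrect_count_perturb (R : realType) (s l : nat) :
  injective g -> (#|U| <= s)%N ->
  `|(incorrect_count D g y missing l)%:R -
    (incorrect_count D g' y' missing' l)%:R| <=
  (s * (dv * dc) ^ l)%:R :> R.
Proof.
move=> gi Us; have /leq_trans := card_affected l gi.
move=> /(_ _ (leq_mul Us (leqnn _))) cB.
apply: (@le_trans _ _ (#|affected l|%:R)); last by rewrite ler_nat.
have half (p p' : pred (edge dv n)) :
    (forall e, e \notin affected l -> p e = p' e) ->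
    #|p|%:R <= #|p'|%:R + #|affected l|%:R :> R.
  move=> pp'; rewrite -natrD ler_nat.
  apply: (@leq_trans #|[predU p' & affected l]|); last first.
    by rewrite -cardUI leq_addr.
  apply: subset_leq_card; apply/fintype.subsetP => e; rewrite !inE => pe.
  case: (boolP (e \in affected l)) => [_|eB]; first by rewrite orbT.
  by rewrite orbF; move: pe; rewrite /in_mem/= pp'.
rewrite ler_distl lerBlDr; apply/andP; split.
  by apply: half => e eB; rewrite /= var_message_unaffected.
by apply: half => e eB; rewrite /= var_message_unaffected.
Qed.

End perturbation.

(** * Swapping two check sockets *)

Section neighbor_swap.
Context (dv dc n : nat) (g : matching dv dc n) (a b : check_socket dv dc n).

Definition swapped_edges : {set edge dv n} :=
  [set e | (a.1 == (g e).1) || (b.1 == (g e).1)]%SET.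

Lemma card_swapped_edges : injective g -> (#|swapped_edges| <= dc + dc)%N.
Proof.
move=> gi; apply: (@leq_trans #|[predU [pred e | a.1 == (g e).1] &
    [pred e | b.1 == (g e).1]]|).
  by apply: subset_leq_card; apply/fintype.subsetP => e; rewrite !inE.
apply: leq_trans (leq_add (card_check_edges a.1 gi) (card_check_edges b.1 gi)).
by rewrite -cardUI leq_addr.
Qed.

(** The transposition fixes every socket of a check node other than those of [a] and [b], so the
    same edge is picked. *)
Lemma check_neighbor_swap e k : e \notin swapped_edges ->
  check_neighbor g e k = check_neighbor (swap a b g) e k.
Proof.
rewrite inE negb_or => /andP[ae be].
have sE (s : check_socket dv dc n) : s.1 = (g e).1 -> tperm a b s = s.
  by move=> se; rewrite tpermD//; apply/eqP => /(congr1 fst);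
    rewrite se => /eqP; rewrite ?(negbTE ae) ?(negbTE be).
rewrite /check_neighbor ffunE sE//; congr odflt; apply: eq_pick => e' /=.
rewrite ffunE; set s := (_, _); have ss : tperm a b s = s by exact: sE.
by rewrite -{2}ss (inj_eq perm_inj).
Qed.

End neighbor_swap.

(** * Measurability of the messages *)

Lemma measurable_coordinate (d d' : measure_display) (T : measurableType d)
    (Y : measurableType d') (I : choiceType) (F : I -> set_system T) (i : I)
    (f : T -> Y) : (forall j, F j setT) ->
  (forall A, measurable A -> F i (f @^-1` A)) ->
  measurable_fun setT (fun x : joint F => f (x i)).
Proof.
move=> FT Ff _ A mA; rewrite setTI.
pose E j := if j == i then f @^-1` A else setT.
have -> : (fun x : joint F => f (x i)) @^-1` A = [set x | forall j, E j (x j)].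
  apply/seteqP; split => [x /= fx j|x /= /(_ i)]; last by rewrite /E eqxx.
  by rewrite /E; case: eqP => // ->.
apply: (measurable_rectangle (J := [fset i]%fset)) => j.
  by rewrite /E; case: eqP => [->|_]; [exact: Ff|exact: FT].
by rewrite inE /E => /negbTE ->.
Qed.

Section message_measurability.
Context (dZ dY dM : measure_display) (S : measurableType dZ)
  (Y : measurableType dY) (M : measurableType dM) (dv dc n : nat)
  (D : decoder Y M dv dc) (h : matching dv dc n)
  (y : S -> 'I_n -> Y) (missing : S -> nat -> edge dv n -> bool).
Hypothesis measurable_y : forall v, measurable_fun setT (y ^~ v).
Hypothesis measurable_missing :
  forall t e, measurable_fun setT (fun x => missing x t e).

Lemma measurable_received t e (m : S -> M) : measurable_fun setT m ->
  measurable_fun setT (fun x => received D (missing x) t e (m x)).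
Proof. by move=> mm; apply: measurable_fun_ifT. Qed.

Lemma measurable_var_message t e :
  measurable_fun setT (fun x => var_message D h (y x) (missing x) t e).
Proof.
elim: t e => [|t IH] e /=.
  exact: measurableT_comp (measurable_init_map D) _.
apply: (measurableT_comp (measurable_var_map D t.+1)).
apply: measurable_fun_pair => //.
apply/measurable_fun_tnthP => k.
rewrite (_ : _ \o _ = fun x => received D (missing x) t.+1 (var_neighbor e k)
    (check_message D h (missing x) t.+1 (var_message D h (y x) (missing x) t)
      (var_neighbor e k))); last by apply/funext => x; rewrite /= tnth_mktuple.
apply: measurable_received.
apply: (measurableT_comp (measurable_check_map D t.+1)).
apply/measurable_fun_tnthP => j.
rewrite (_ : _ \o _ = fun x => received D (missing x) t.+1
    (check_neighbor h (var_neighbor e k) j)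
    (var_message D h (y x) (missing x) t (check_neighbor h (var_neighbor e k) j)));
  last by apply/funext => x; rewrite /= tnth_mktuple.
exact: measurable_received.
Qed.

Lemma bmf_incorrect_count (R : realType) l :
  bmf (fun x => (incorrect_count D h (y x) (missing x) l)%:R : R).
Proof.
have -> : (fun x => (incorrect_count D h (y x) (missing x) l)%:R : R) =
    fun x => \sum_e (represents D (var_message D h (y x) (missing x) l e)
                       != Some plus_one)%:R.
  apply/funext => x; rewrite /incorrect_count -sum1_card natr_sum big_mkcond.
  by apply: eq_bigr => e _; rewrite inE; case: ifP.
apply: bmf_sum => e; apply: bmf_indic.
rewrite (_ : [set x | _] = ~` ((fun x => var_message D h (y x) (missing x) l e)
    @^-1` (represents D @^-1` [set Some plus_one]))); last first.
  by apply/seteqP; split => x /= /eqP.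
apply: measurableC; rewrite -[X in measurable X]setTI.
exact: measurable_var_message (measurable_represents D _).
Qed.

End message_measurability.

Lemma var_message_eq_missing (dY dM : measure_display) (Y : measurableType dY)
    (M : measurableType dM) (dv dc n : nat) (D : decoder Y M dv dc)
    (h : matching dv dc n) (y : 'I_n -> Y)
    (missing missing' : nat -> edge dv n -> bool) t e :
  (forall s e', (s <= t)%N -> missing s e' = missing' s e') ->
  var_message D h y missing t e = var_message D h y missing' t e.
Proof.
elim: t e => [//|t IH] e mE /=; congr (var_map D t.+1 (_, _)).
apply: eq_mktuple => k; rewrite /received mE//; case: ifP => // _.
congr (check_map D t.+1 _); apply: eq_mktuple => j; rewrite /received mE// IH//.
by move=> s e' st; apply: mE; exact: leqW.
Qed.

Lemma exists_perfect_matching dv dc n : (dc %| n * dv)%N ->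
  exists g : matching dv dc n, injective g.
Proof.
move=> dcn.
have EE : #|edge dv n| = #|check_socket dv dc n|.
  by rewrite !card_prod !card_ord divnK.
exists [ffun e => enum_val (cast_ord EE (enum_rank e))] => e e'.
by rewrite !ffunE => /enum_val_inj/cast_ord_inj/enum_rank_inj.
Qed.

(** * Concentration of the number of errors *)

Section random_ldpc.
Context (R : realType) (d dY dM : measure_display) (T : measurableType d)
  (Y : measurableType dY) (M : measurableType dM) (P : probability T R)
  (dv dc n l : nat) (D : decoder Y M dv dc) (K : choiceType)
  (G : T -> matching dv dc n) (X : 'I_n -> {RV P >-> Y})
  (B : K -> {RV P >-> bool}) (W : symbol -> probability Y R) (alpha : R).

(* [flag t e] indexes the flag deciding whether [e] is missing in iteration
   [t]: it depends on [t] for transiently missing connections only. *)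
Context (flag : nat -> edge dv n -> K) (flags : seq K).

Hypothesis model : random_model G X B W alpha.
Hypothesis flag_edge : forall t t' e e', flag t e = flag t' e' -> e = e'.
Hypothesis flag_flags : forall t e, (t <= l)%N -> flag t e \in flags.
Hypothesis dc_dvd : (dc %| n * dv)%N.

Local Notation F := (generated_events G X B).
Local Notation injections :=
  [pred h : {ffun edge dv n -> check_socket dv dc n} | injectiveb h].

Lemma generated_events_measurable i A : F i A -> measurable A.
Proof.
case: i => [[v|k]|] /= [C mC <-]; rewrite setTI.
- by rewrite -[X in measurable X]setTI; exact: (measurable_funP (X v)).
- by rewrite -[X in measurable X]setTI; exact: (measurable_funP (B k)).
- have -> : G @^-1` C = \bigcup_(h in C) (G @^-1` [set h]).
    by apply/seteqP; split => [w /= Cw|w [h Ch /= ->//]]; exists (G w).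
  apply: fin_bigcup_measurable => [|h _]; first exact: finite_finset.
  exact: (matching_measurable model).
Qed.

Lemma generated_events_setT i : F i setT.
Proof. by case: i => [[v|k]|]; exists setT; rewrite ?setTI. Qed.

Lemma generated_events_setI i : setI_closed (F i).
Proof.
case: i => [[v|k]|] _ _ [C mC <-] [C' mC' <-]; exists (C `&` C');
  rewrite ?setTI//; exact: measurableI.
Qed.

(** The matching is frozen to [h], and each channel value and flag reads its own sample point; at
    [h = G w] on the diagonal this is the actual count. *)
Definition errors (h : matching dv dc n) (x : joint F) : R :=
  (incorrect_count D h (fun v => X v (x (Some (inl v))))
    (fun t e => B (flag t e) (x (Some (inr (flag t e))))) l)%:R.

Lemma bmf_errors h : bmf (errors h).
Proof.
apply: bmf_incorrect_count => [v|t e]; apply: measurable_coordinate;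
  try exact: generated_events_setT.
- by move=> A mA; exists A => //; rewrite setTI.
- by move=> A mA; exists A => //; rewrite setTI.
Qed.

Definition coordinates : seq (option ('I_n + K)) :=
  [seq Some (inl v) | v <- enum 'I_n] ++ [seq Some (inr k) | k <- flags].

Lemma size_coordinates : size coordinates = (n + size flags)%N.
Proof. by rewrite size_cat (size_map _ (enum _)) size_enum_ord size_map. Qed.

Lemma errors_determined h : determined_on coordinates (errors h).
Proof.
move=> x x' xx'; rewrite /errors /incorrect_count; congr (_%:R).
have vE v : x (Some (inl v)) = x' (Some (inl v)).
  by apply: xx'; rewrite mem_cat map_f// mem_enum.
apply: eq_card => e; rewrite !inE; congr (represents D _ != _).
rewrite (_ : (fun v => X v (x (Some (inl v)))) =
    fun v => X v (x' (Some (inl v)))); last by apply/funext => v; rewrite vE.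
apply: var_message_eq_missing => s e' sl; congr (B _ _); apply: xx'.
by rewrite mem_cat [X in _ || X]map_f ?orbT// flag_flags.
Qed.

(** A channel value touches at most [dv] edges, a flag one, a socket swap at most [dc + dc]; the sum
    covers the three cases, and [l] iterations multiply it by at most [(dv * dc) ^ l]. *)
Definition sensitivity : nat := ((dv + (dc + dc)) * (dv * dc) ^ l)%N.

Lemma errors_upd (h : matching dv dc n) i x u v : injective h -> (0 < dv)%N -> i \in coordinates ->
  `|errors h (upd F x i u) - errors h (upd F x i v)| <= sensitivity%:R.
Proof.
move=> hi dv0; rewrite mem_cat => /orP[/mapP[w _ ->]|/mapP[k _ ->]].
- apply: (incorrect_count_perturb D (U := [set e | w == e.1]%SET)) => //.
  + move=> e; rewrite inE /upd => we; case: eqP => // -[ew].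
    by rewrite ew eqxx in we.
  + apply: leq_trans (leq_addr _ _).
    rewrite (_ : #|_| = #|[pred e : edge dv n | w == e.1]|).
      exact: card_variable_edges.
    by apply: eq_card => e; rewrite !inE.
(* By [flag_edge] a flag concerns a single edge, possibly in many iterations; a flag attached to no
   edge changes nothing. *)
- have [[[t0 e0] fk]|nofk] := pselect (exists te : nat * edge dv n, flag te.1 te.2 = k).
    apply: (incorrect_count_perturb D (U := [set e0]%SET)) => //.
      move=> t e; rewrite inE /upd => ee0; case: eqP => // -[fke].
      by rewrite /= -fke in fk; rewrite (flag_edge fk) eqxx in ee0.
    by rewrite cards1 addn_gt0 dv0.
  apply: (incorrect_count_perturb D (U := finset.set0)) => //.
    move=> t e _; rewrite /upd; case: eqP => // -[fke].
    by case: nofk; exists (t, e).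
  by rewrite cards0.
Qed.

Lemma errors_swap (h : matching dv dc n) a b x : injective h ->
  `|errors (swap a b h) x - errors h x| <= sensitivity%:R.
Proof.
move=> hi; rewrite distrC.
apply: (incorrect_count_perturb D (U := swapped_edges h a b)) => //.
- by move=> e k; exact: check_neighbor_swap.
- exact: leq_trans (card_swapped_edges _ _ hi) (leq_addl _ _).
Qed.

(** * Averaging over the random matching *)

Definition matching_prob h : R := \int[P]_w (G w == h)%:R.

Lemma measurable_matching h : measurable [set w | G w == h].
Proof.
rewrite (_ : [set w | _] = G @^-1` [set h]); first exact: (matching_measurable model).
by apply/seteqP; split => w /= /eqP.
Qed.

(** Split according to the value of [G] and resample coordinate [None]: only the indicator of
    [G w == h] depends on it, and it integrates to [matching_prob h]. *)
Lemma expect_matching (H : matching dv dc n -> joint F -> R) :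
    (forall h, bmf (H h)) ->
    (forall h x u, H h (upd F x None u) = H h x) ->
  \int[P]_w H (G w) (diag F w) =
  \sum_h matching_prob h * \int[P]_w H h (diag F w).
Proof.
move=> bH Hinv.
have bGH h : bmf (fun x : joint F => (G (x None) == h)%:R * H h x).
  apply: bmfM => //; apply: (bmf_indic R (b := fun x : joint F => G (x None) == h)).
  have mG : measurable_fun setT (fun x : joint F => G (x None) == h).
    apply: (measurable_coordinate (f := fun w => G w == h)) => [j|A mA].
      exact: generated_events_setT.
    by exists [set g | A (g == h)] => //; rewrite setTI.
  by rewrite -[X in measurable X]setTI; exact: mG measurableT [set true] _.
have Fm := generated_events_measurable.
transitivity (\int[P]_w \sum_h (G w == h)%:R * H h (diag F w)).
  apply: eq_Rintegral => w _; rewrite (bigD1 (G w))//= eqxx mul1r big1 ?addr0//.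
  by move=> h /negbTE; rewrite eq_sym => ->; rewrite mul0r.
rewrite (expect_sum P _ (F := fun h w => (G w == h)%:R * H h (diag F w))); last first.
  by move=> h; have := bmf_diag Fm (bGH h).
apply: eq_bigr => h _.
have := expect_resample Fm generated_events_setT generated_events_setI
  (model_independent model) None (bGH h).
move=> /= ->; rewrite -expectZ; last exact: (bmf_diag Fm (bH h)).
apply: eq_Rintegral => w _.
rewrite /resample /matching_prob mulrC -expectZ; last first.
  exact: (bmf_indic R (measurable_matching h)).
by apply: eq_Rintegral => u _; rewrite Hinv mulrC /upd eqxx.
Qed.

Lemma matching_prob_ge0 h : 0 <= matching_prob h.
Proof. by apply: Rintegral_ge0 => w _. Qed.

Lemma matching_prob_injective (h : matching dv dc n) : injectiveb h ->
  matching_prob h = #|injections|%:R^-1.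
Proof.
move=> hi; apply: EFin_inj; rewrite expect_indic; last exact: measurable_matching.
have <- : #|perfect_matchings dv dc n| = #|injections|.
  by apply: eq_card => g; rewrite !inE.
rewrite -(matching_uniform model (h := h)); last by rewrite inE.
by congr (P _); apply/seteqP; split => w /= /eqP.
Qed.

Lemma sum_matching_prob : \sum_h matching_prob h = 1.
Proof.
have := @expect_matching (fun _ _ => 1) (fun=> bmf_cst _ 1) (fun _ _ _ => erefl).
rewrite expect_cst => ->; apply: eq_bigr => h _; by rewrite mulr1.
Qed.

Lemma card_injections_gt0 : (0 < #|injections|)%N.
Proof.
have [g gi] := exists_perfect_matching dc_dvd.
by apply/card_gt0P; exists g; rewrite inE; apply/injectiveP.
Qed.

(** The model prescribes the probabilities of the perfect matchings only, but these already sum to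
    1. *)
Lemma matching_prob_not_injective (h : matching dv dc n) : ~~ injectiveb h -> matching_prob h = 0.
Proof.
move=> hi; have := sum_matching_prob.
rewrite (bigID (fun h : matching dv dc n => injectiveb h))/=.
rewrite (eq_bigr (fun=> #|injections|%:R^-1)); last first.
  by move=> g; exact: matching_prob_injective.
rewrite sumr_const -[_ *+ _]mulr_natl divff; last first.
  by rewrite pnatr_eq0 -lt0n card_injections_gt0.
move=> /eqP; rewrite -[X in _ == X]addr0 (inj_eq (addrI _)).
rewrite psumr_eq0; last by move=> g _; exact: matching_prob_ge0.
by move=> /allP/(_ h); rewrite mem_index_enum hi => /(_ isT)/eqP.
Qed.

Lemma expect_matching_mean (H : matching dv dc n -> joint F -> R) :
    (forall h, bmf (H h)) ->
    (forall h x u, H h (upd F x None u) = H h x) ->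
  \int[P]_w H (G w) (diag F w) =
  mean injections (fun h => \int[P]_w H h (diag F w)).
Proof.
move=> bH Hinv; rewrite expect_matching// (bigID (fun h => injections h))/=.
rewrite [X in _ + X]big1 ?addr0; last first.
  by move=> h hi; rewrite matching_prob_not_injective// mul0r.
rewrite /mean mulrC mulr_sumr; apply: eq_bigr => h hi.
by rewrite matching_prob_injective.
Qed.

(** * Exponential moments and tail of the number of errors *)

Definition num_errors (w : T) : nat :=
  incorrect_count D (G w) (X ^~ w) (fun t e => B (flag t e) w) l.

Lemma errors_None h x u : errors h (upd F x None u) = errors h x.
Proof. by []. Qed.

Definition mean_errors : R := \int[P]_w (num_errors w)%:R.

(** The deviation is [errors h - m h] plus [m h - c]. Given the matching, the first part costs one
    factor per channel value and flag; the second costs one per edge of the random matching. *)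
Lemma mgf_num_errors (t : R) : (0 < dv)%N ->
  \int[P]_w expR (t * ((num_errors w)%:R - mean_errors)) <=
  expR ((n + size flags + n * dv)%:R * (2 * (t * sensitivity%:R) ^+ 2)).
Proof.
move=> dv0; pose m h := \int[P]_w errors h (diag F w).
have Fm := generated_events_measurable.
have -> : mean_errors = mean injections m.
  exact: (expect_matching_mean bmf_errors errors_None).
set c := mean injections m.
pose H h x := expR (t * (errors h x - c)).
have bH h : bmf (H h).
  by apply/bmf_expR/bmfZ/bmfB; [exact: bmf_errors|exact: bmf_cst].
rewrite [leLHS](_ : _ = mean injections (fun h => \int[P]_w H h (diag F w))); last first.
  exact: (expect_matching_mean bH (fun _ _ _ => erefl)).
set kap := 2 * _ ^+ 2.
have N0 : 0 < #|injections|%:R :> R by rewrite ltr0n card_injections_gt0.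
rewrite /mean ler_pdivrMr//.
apply: (@le_trans _ _ (\sum_(h | injections h)
    expR ((n + size flags)%:R * kap) * expR (t * (m h - c)))).
  apply: ler_sum => h /injectiveP hi.
  have := mgf_bounded_differences Fm generated_events_setT generated_events_setI
    (model_independent model) t (bmf_errors h) (errors_determined h)
    (fun i x u v => errors_upd x u v hi dv0).
  rewrite size_coordinates -/(m h) => mgf.
  rewrite [X in X <= _](_ : _ = expR (t * (m h - c)) *
      \int[P]_w expR (t * (errors h (diag F w) - m h))); last first.
    rewrite -expectZ; last first.
      apply/bmf_expR/bmfZ/bmfB; last exact: bmf_cst.
      exact: (bmf_diag Fm (bmf_errors h)).
    apply: eq_Rintegral => w _; rewrite -expRD -mulrDr; congr (expR (t * _)).
    by ring.
  by rewrite mulrC ler_pM2r ?expR_gt0.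
have -> : expR ((n + size flags + n * dv)%:R * kap) =
    expR ((n + size flags)%:R * kap) * expR ((n * dv)%:R * kap).
  by rewrite -expRD -mulrDl -natrD.
rewrite -mulr_sumr -mulrA ler_pM2l ?expR_gt0//.
have [g0 g0i] := exists_perfect_matching dc_dvd.
have := mgf_random_injection (f := m) (c := sensitivity%:R) t _ g0i.
rewrite card_prod !card_ord [leRHS]mulrC; apply=> h a b hi.
(* A swap changes the conditional mean [m] by at most the pointwise bound of [errors_swap]. *)
have bE h' : bmf (fun w => errors h' (diag F w)) by exact: (bmf_diag Fm (bmf_errors h')).
rewrite /m -expectB//; apply: le_norm_expect; first exact: bmfB.
by move=> w; exact: errors_swap.
Qed.

Lemma bmf_num_errors : bmf (fun w => (num_errors w)%:R : R).
Proof.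
have -> : (fun w => (num_errors w)%:R : R) =
    fun w => \sum_h (G w == h)%:R * errors h (diag F w).
  apply/funext => w; rewrite (bigD1 (G w))//= eqxx mul1r big1 ?addr0//.
  by move=> h /negbTE; rewrite eq_sym => ->; rewrite mul0r.
apply: bmf_sum => h; apply: bmfM; first exact: (bmf_indic R (measurable_matching h)).
exact: (bmf_diag generated_events_measurable (bmf_errors h)).
Qed.

Lemma num_errors_tail (a t : R) : (0 < dv)%N -> 0 <= t ->
  (P [set w | (a < `|(num_errors w)%:R - mean_errors|)%R] <=
   (2 * expR (- (t * a) + (n + size flags + n * dv)%:R *
                          (2 * (t * sensitivity%:R) ^+ 2)))%:E)%E.
Proof.
move=> dv0 t0; set k := (n + _ + _)%:R * _.
have bN := bmf_num_errors.
have bNc : bmf (fun w => (num_errors w)%:R - mean_errors).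
  by apply: bmfB => //; exact: bmf_cst.
have be r : bmf (fun w => expR (r * ((num_errors w)%:R - mean_errors))).
  exact/bmf_expR/bmfZ.
have mA : measurable [set w | a < `|(num_errors w)%:R - mean_errors|].
  have mN : measurable_fun setT (fun w => `|(num_errors w)%:R - mean_errors|).
    by apply: measurableT_comp => //; exact: bNc.1.
  rewrite (_ : [set w | _] = (fun w => `|(num_errors w)%:R - mean_errors|) @^-1`
    `]a, +oo[); last by apply/seteqP; split => w /=; rewrite in_itv/= andbT.
  by rewrite -[X in measurable X]setTI; exact: mN.
rewrite -(expect_indic P (b := fun w => a < `|(num_errors w)%:R - mean_errors|))//.
(* Chernoff's bound for both tails at once: with [z] the deviation, the indicator is at most [expR
   (- (t * a)) * (expR (t * z) + expR (- t * z))]. *)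
rewrite lee_fin; apply: (@le_trans _ _ (\int[P]_w (expR (- (t * a)) *
    (expR (t * ((num_errors w)%:R - mean_errors)) +
     expR (- t * ((num_errors w)%:R - mean_errors))))));
  [apply: le_expect|].
- exact: bmf_indic.
- by apply: bmfZ; apply: bmfD; exact: be.
- move=> w; set z := _%:R - _; case: ltP => [az|_]; last first.
    by rewrite mulr_ge0 ?addr_ge0 ?expR_ge0.
  have [z0|z0] := leP 0 z.
    rewrite ger0_norm// in az; apply: (@le_trans _ _ (expR (- (t * a)) * expR (t * z))).
      by rewrite -expRD -expR0 ler_expR; nra.
    by rewrite ler_pM2l ?expR_gt0// lerDl expR_ge0.
  rewrite ltr0_norm// in az; apply: (@le_trans _ _ (expR (- (t * a)) * expR (- t * z))).
    by rewrite -expRD -expR0 ler_expR; nra.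
  by rewrite ler_pM2l ?expR_gt0// lerDr expR_ge0.
rewrite expectZ; last by apply: bmfD; exact: be.
rewrite expectD// expRD mulrCA ler_pM2l ?expR_gt0//.
have -> : 2 * expR k = expR k + expR k by ring.
apply: lerD; first exact: mgf_num_errors.
by apply: le_trans (mgf_num_errors _ dv0) _; rewrite mulNr sqrrN.
Qed.

(** Per variable node there are one channel value, at most [l.+1 * dv] flags and [dv] matching
    edges, whence the factor [1 + l.+2 * dv]. *)
Lemma concentration_num_errors : (0 < dv)%N -> (0 < dc)%N ->
    (size flags <= l.+1 * (n * dv))%N ->
  concentration P dv n
    (dv%:R ^+ 2 / (32 * (1 + l.+2 * dv)%:R * sensitivity%:R ^+ 2)) num_errors.
Proof.
move=> dv0 dc0 sflags eps eps0.
set L : R := (1 + l.+2 * dv)%:R; set C : R := sensitivity%:R.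
have C0 : 0 < C by rewrite ltr0n muln_gt0 addn_gt0 dv0/= expn_gt0 muln_gt0 dv0 dc0.
have L0 : 0 < L by rewrite ltr0n.
have -> : ('E_P[(fun w => (num_errors w)%:R : R)] = mean_errors%:E)%E.
  rewrite unlock /mean_errors /Rintegral fineK//.
  exact: integrable_fin_num (bmf_integrable P bmf_num_errors).
set a : R := (n * dv)%:R * eps / 2.
rewrite (_ : [set w | _] =
    [set w | (a < `|(num_errors w)%:R - mean_errors|)%R]); last first.
  by apply/seteqP; split => w /=; rewrite lte_fin.
(* For [n > 0], this minimises [- (t * a) + n%:R * L * (2 * (t * C) ^+ 2)], with minimum [- (dv%:R
   ^+ 2 * eps ^+ 2 * n%:R / (32 * L * C ^+ 2))]. *)
pose t : R := dv%:R * eps / (8 * L * C ^+ 2).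
have t0 : 0 <= t by rewrite divr_ge0 ?mulr_ge0 ?ler0n ?exprn_ge0 ?ltW.
apply: le_trans (num_errors_tail a dv0 t0) _.
rewrite lee_fin ler_pM2l// ler_expR -/C.
apply: (@le_trans _ _ (- (t * a) + (n%:R * L) * (2 * (t * C) ^+ 2))).
  rewrite lerD2l; apply: ler_wpM2r; first by rewrite mulr_ge0 ?sqr_ge0.
  rewrite /L -natrM ler_nat.
  by apply: (@leq_trans (n + l.+1 * (n * dv) + n * dv)); [|]; lia.
rewrite le_eqVlt; apply/orP; left; apply/eqP.
rewrite /t /a natrM; field.
by rewrite !gt_eqF.
Qed.

End random_ldpc.

Theorem theorem1 (R : realType) (dv dc l : nat)
    (hdv : (2 <= dv)%N) (hdc : (2 <= dc)%N) :
  exists2 beta : R, 0 < beta &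
    forall (n : nat), (dc %| n * dv)%N ->
    forall (alpha : R), 0 <= alpha <= 1 ->
    forall (dY : measure_display) (Y : measurableType dY)
      (W : symbol -> probability Y R), bms_channel W ->
    forall (dM : measure_display) (M : measurableType dM)
      (D : decoder Y M dv dc)
      (d : measure_display) (T : measurableType d) (P : probability T R)
      (G : T -> matching dv dc n) (X : 'I_n -> {RV P >-> Y}),
    (* permanently missing connections: one flag per edge *)
    (forall B : edge dv n -> {RV P >-> bool},
       random_model G X B W alpha ->
       concentration P dv n beta (fun w : T =>
         incorrect_count D (G w) (fun v => X v w) (fun _ e => B e w) l)) /\
    (* transiently missing connections: one flag per iteration and edge *)
    (forall B : nat * edge dv n -> {RV P >-> bool},
       random_model G X B W alpha ->
       concentration P dv n beta (fun w : T =>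
         incorrect_count D (G w) (fun v => X v w) (fun t e => B (t, e) w) l)).
Proof.
have dv0 : (0 < dv)%N by exact: ltnW.
have dc0 : (0 < dc)%N by exact: ltnW.
exists (dv%:R ^+ 2 / (32 * (1 + l.+2 * dv)%:R * (sensitivity dv dc l)%:R ^+ 2)).
  have C0 : (0 < sensitivity dv dc l)%N.
    by rewrite muln_gt0 addn_gt0 dv0 expn_gt0 muln_gt0 dv0 dc0.
  by rewrite divr_gt0 ?mulr_gt0 ?exprn_gt0 ?ltr0n.
move=> n dcn alpha _ dY Y W _ dM M D d T P G X.
have cardE' : #|edge dv n| = (n * dv)%N by rewrite card_prod !card_ord.
split=> B model.
(* Permanent case: the flag of an edge is the same in all iterations. *)
- apply: (concentration_num_errors D (flag := fun _ e => e)
    (flags := enum (edge dv n)) model) => //.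
  + by move=> t e _; rewrite mem_enum.
  + by rewrite -cardE cardE' leq_pmull.
(* Transient case: the flags of iterations 0 to [l] make up exactly the allowed
   [l.+1 * (n * dv)]. *)
- apply: (concentration_num_errors D (flag := fun t e => (t, e))
    (flags := [seq (t, e) | t <- iota 0 l.+1, e <- enum (edge dv n)]) model) => //.
  + by move=> t t' e e' [].
  + by move=> t e tl; apply: allpairs_f; rewrite ?mem_enum// mem_iota.
  + by rewrite size_allpairs size_iota -cardE cardE'.
Qed.
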